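(* There is an absolute constant $c>0$ such that the following holds. Let $F$ be a field of odd positive characteristic $p$, let $A\subset F_*=F\setminus\{0\}$ be a finite set with $|A|>1$ and $|A|<p^{8/13}$, and let $\alpha\in F_*$. Then $$|A(A+\alpha)|\ \ge\ c\,|A|^{9/8}.$$
   Context: $A(A+\alpha)=\{a(b+\alpha): a,b\in A\}$. *)

(* Defs.v *)
From mathcomp Require Import all_boot all_algebra.
From mathcomp Require Import finmap.

Set Implicit Arguments.
Unset Strict Implicit.
Unset Printing Implicit Defensive.

Local Open Scope ring_scope.

Definition prod_shift (F : fieldType) (A : {fset F}) (alpha : F) : {fset F} :=
  [fset a * (b + alpha) | a in A, b in A]%fset.

(* Main.v *)
Require Import Defs.
From mathcomp Require Import all_boot all_order all_algebra.
From mathcomp Require Import finmap.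
From mathcomp Require Import all_classical all_reals all_analysis.
From mathcomp Require Import -(notations) mpoly.
From mathcomp Require Import fintype finset ring lra zify.

(* Let P = A(A + alpha) and V = {1 / (b + alpha) : b in A, b <> - alpha}.  For
   a, c in A and v in V the element w = c (alpha + a) of P is also x (alpha + p v) with x = c
   and p = a / v in P.  Hence by Cauchy-Schwarz the equation
   x1 (alpha + p1 v1) = x2 (alpha + p2 v2) has at least (|A|^2 |V|)^2 / |P|
   solutions.  A solution is an incidence between the point (p1, x2, v2) and the
   plane (p2, x1, v1), so Rudnev's point-plane bound O(n^(3/2) + k n), with
   n = |P| |A| |V| and at most k = |A| collinear points, gives the estimate.

   For the incidence bound, a projective frame that is generic over F(t) turns
   the points and planes into lines (x_i, s, z_i + y_i s) and
   (s, b_j, c_j + a_j s) of 3-space, with distinct x_i and distinct b_j, so that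
   incidence becomes intersection.  Some f of degree d = O(n^(1/2)) vanishes on
   the first family, hence on the lines of the second that meet it often.  If
   there are more than (5 d + k) intersections per line, take d minimal; then
   one may assume that f_Z vanishes on no line and that every line is met more
   than 4 d + k times.  On the surface f = 0 regard Z as a function of X and Y.
   Z_XX vanishes on the second family, therefore on the first family, because
   its lines are met so often, and therefore Z_XXY vanishes on the second
   family.  So along each line of the second family the slope Z_Y = - f_Y / f_Z
   has zero second derivative and, as 2 d <= p, is linear.  The lines of the
   first family that meet it then come from more than k collinear points. *)

Set Implicit Arguments.
Unset Strict Implicit.
Unset Printing Implicit Defensive.

Import Order.TTheory GRing.Theory Num.Theory.
Local Open Scope ring_scope.

Local Notation msize := (mmeasure mdeg).

(** * Wronskians in small degree *)

Section Univariate.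
Variables (K : fieldType) (p : nat).
Hypothesis charK : p \in [pchar K].

Lemma natf_small_neq0 (n : nat) : (0 < n)%N -> (n < p)%N -> n%:R != 0 :> K.
Proof.
move=> n0 np; rewrite -(dvdn_pcharf charK).
by apply/negP => /dvdn_leq - /(_ n0); rewrite leqNgt np.
Qed.

(** In degree deg u + deg v - 1 the two products have coefficient [lead_coef u * lead_coef v] times
    deg u and deg v respectively. Both degrees are below [p], so they agree. *)
Lemma size_eq_of_wronskian0 (u v : {poly K}) :
  u != 0 -> v != 0 -> (size u <= p)%N -> (size v <= p)%N ->
  u^`() * v = u * v^`() -> size u = size v.
Proof.
move=> u0 v0 su sv W.
have su0 : (0 < size u)%N by rewrite size_poly_gt0.
have sv0 : (0 < size v)%N by rewrite size_poly_gt0.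
have key (w t : {poly K}) : w != 0 -> t != 0 ->
   (w^`() * t)`_((size w).-1 + (size t).-1).-1 =
     lead_coef w * lead_coef t *+ (size w).-1.
  move=> w0 t0.
  have sw0 : (0 < size w)%N by rewrite size_poly_gt0.
  have st0 : (0 < size t)%N by rewrite size_poly_gt0.
  case: (posnP (size w).-1) => [E|P].
    have/eqP -> : w^`() == 0.
      have /size1_polyC -> : (size w <= 1)%N by lia.
      by rewrite derivC.
    by rewrite E mul0r coef0.
  have H : ((size w).-1.-1 < ((size w).-1 + (size t).-1).-1.+1)%N by lia.
  rewrite coefM (bigD1 (Ordinal H)) //= big1 ?addr0.
    rewrite coef_deriv.
    have -> : ((size w).-1.-1.+1 = (size w).-1)%N by lia.
    have -> : (((size w).-1 + (size t).-1).-1 - (size w).-1.-1 = (size t).-1)%N by lia.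
    by rewrite mulrnAl -!lead_coefE.
  move=> i /eqP ni.
  have {}ni : (i : nat) <> (size w).-1.-1 by move=> e; apply: ni; apply: val_inj.
  rewrite coef_deriv.
  case: (ltnP i (size w).-1.-1) => h.
    rewrite [t`__]nth_default ?mulr0 //.
    have aux (a b c : nat) : (c < a.-1.-1)%N -> (0 < b)%N ->
      (b <= (a.-1 + b.-1).-1 - c)%N by lia.
    exact: aux.
  rewrite nth_default ?mul0rn ?mul0r //.
  have aux (a c : nat) : c <> a.-1.-1 -> (a.-1.-1 <= c)%N -> (0 < a.-1)%N ->
    (a <= c.+1)%N by lia.
  exact: aux.
have L0 : lead_coef u * lead_coef v != 0 by rewrite mulf_neq0 ?lead_coef_eq0.
have E : lead_coef u * lead_coef v *+ (size u).-1 = lead_coef u * lead_coef v *+ (size v).-1.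
  rewrite -key // [in RHS]mulrC -key // W [u * _]mulrC; congr (_`__).
  by rewrite addnC.
have aux (m n : nat) : (m < n)%N -> (n < p)%N ->
    lead_coef u * lead_coef v *+ m = lead_coef u * lead_coef v *+ n -> False.
  move=> mn np /eqP; rewrite eq_sym -subr_eq0 -mulrnBr ?(ltnW mn) //.
  rewrite -mulr_natr mulf_eq0 (negbTE L0) /=.
  by apply/negP/natf_small_neq0; lia.
case: (ltngtP (size u).-1 (size v).-1) => h.
- by case: (aux _ _ h _ E); lia.
- by case: (aux _ _ h _ (esym E)); lia.
- by rewrite -(prednK su0) -(prednK sv0) h.
Qed.

(** Subtracting from [u] the multiple of [v] with the same leading term keeps the equation but
    lowers the degree, so the difference vanishes. *)
Lemma scale_of_wronskian0 (u v : {poly K}) :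
  v != 0 -> (size u <= p)%N -> (size v <= p)%N ->
  u^`() * v = u * v^`() -> exists g : K, u = g *: v.
Proof.
move=> v0 su sv W.
have [->|u0] := eqVneq u 0; first by exists 0; rewrite scale0r.
have suv := size_eq_of_wronskian0 u0 v0 su sv W.
pose g := lead_coef u / lead_coef v.
exists g; apply/eqP; rewrite -subr_eq0; apply/negPn/negP => w0.
have lv0 : lead_coef v != 0 by rewrite lead_coef_eq0.
have W' : (u - g *: v)^`() * v = (u - g *: v) * v^`().
  rewrite derivB derivZ !mulrBl W -!scalerAl.
  by rewrite [v^`() * v]mulrC.
have sv0 : (0 < size v)%N by rewrite size_poly_gt0.
have slt : (size (u - g *: v)%R < size v)%N.
  rewrite -(prednK sv0) ltnS; apply/leq_sizeP => j.
  rewrite leq_eqVlt => /orP[/eqP <-|hj].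
    by rewrite coefB coefZ -{1}suv -!lead_coefE /g divfK ?subrr.
  have hv : (size v <= j)%N by lia.
  by rewrite coefB coefZ !nth_default ?mulr0 ?subr0 ?suv.
have e := size_eq_of_wronskian0 w0 v0 (leq_trans (ltnW slt) sv) sv W'.
by rewrite e ltnn in slt.
Qed.

(* The hypothesis says that the second derivative of [N / M] vanishes. *)
Lemma linear_quotient (d : nat) (N M : {poly K}) :
  (d + d <= p)%N -> (size N <= d)%N -> (size M <= d)%N -> M != 0 ->
  M ^+ 2 * N^`()^`() - 2%:R * M * M^`() * N^`() - N * M * M^`()^`()
    + 2%:R * N * M^`() ^+ 2 = 0 ->
  exists e g : K, N = (e%:P + g *: 'X) * M.
Proof.
move=> dp sN sM M0 Q0.
have sM0 : (0 < size M)%N by rewrite size_poly_gt0.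
have sD (q : {poly K}) : (size q <= d)%N -> (size q^`() <= d.-1)%N.
  move=> h; have [->|q0] := eqVneq q 0; first by rewrite deriv0 size_poly0.
  by have := lt_size_deriv q0; lia.
have sMul (q r : {poly K}) m n : (size q <= m)%N -> (size r <= n)%N -> (size (q * r)%R <= (m + n).-1)%N.
  by move=> h1 h2; apply: leq_trans (size_polyMleq _ _) _; lia.
(* [W] is [M ^+ 2] times the derivative of [N / M], so by hypothesis [W / M ^+ 2] has derivative
   zero. Hence [W] is a constant [g] times [M ^+ 2], and [N - g *: 'X * M] has zero Wronskian with
   [M]. *)
pose W := N^`() * M - N * M^`().
have sW : (size W <= p)%N.
  have s1 : (size (N^`() * M)%R <= p)%N.
    by apply: leq_trans (sMul _ _ _ _ (sD _ sN) sM) _; lia.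
  have s2 : (size (N * M^`())%R <= p)%N.
    by apply: leq_trans (sMul _ _ _ _ sN (sD _ sM)) _; lia.
  by rewrite /W (leq_trans (size_polyD _ _)) // size_polyN geq_max s1.
have sM2 : (size (M ^+ 2)%R <= p)%N.
  by rewrite expr2; apply: leq_trans (sMul _ _ _ _ sM sM) _; lia.
have [||g Wg] := scale_of_wronskian0 (u := W) (v := M ^+ 2) _ sW sM2.
- by rewrite expf_neq0.
- rewrite -[LHS]subr0 -[X in _ - X](mulr0 M) -Q0 /W !expr2 !(derivB, derivM); ring.
have [|||e Ne] := scale_of_wronskian0 (u := N - g *: 'X * M) (v := M) M0.
- apply: leq_trans (size_polyD _ _) _; rewrite size_polyN geq_max.
  rewrite (leq_trans sN) ?(leq_trans (sMul _ _ 2 d _ sM)) //; try lia.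
  by apply: leq_trans (size_scale_leq _ _) _; rewrite size_polyX.
- by lia.
- rewrite derivB derivM derivZ derivX.
  apply/eqP; rewrite -subr_eq0; apply/eqP.
  rewrite -[RHS](subrr (g *: M ^+ 2)) -{1}Wg /W -!mul_polyC; ring.
exists e, g; rewrite mulrDl mul_polyC -Ne subrK //.
Qed.

End Univariate.

(** * Restriction of polynomials to lines *)

Section Substitution.
Variables (K : fieldType) (n : nat).
Implicit Types (f g : mpoly n K) (h : 'I_n -> {poly K}).

(** Chain rule along the curve [h]. The identity passes to sums and products, so constants and
    variables suffice. *)
Lemma deriv_mmap h f :
  (mmap polyC h f)^`() = \sum_i mmap polyC h (mderiv i f) * (h i)^`().
Proof.
pose P g := (mmap polyC h g)^`() = \sum_i mmap polyC h (mderiv i g) * (h i)^`().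
have PC c : P (mpolyC n c).
  rewrite /P mmapC derivC big1 // => i _.
  by rewrite mderivC mmap0 mul0r.
have PM g1 g2 : P g1 -> P g2 -> P (g1 * g2).
  rewrite /P => h1 h2; rewrite rmorphM derivM h1 h2 mulr_suml mulr_sumr -big_split /=.
  apply: eq_bigr => i _; rewrite mderivM rmorphD !rmorphM; ring.
have PX i : P (mpolyX K (mnm1 i)).
  rewrite /P mmapX mmap1U (bigD1 i) //= big1 => [|j ji].
    have E : mnm_sub (mnm1 i) (mnm1 i) = mnm0 :> multinom n.
      by apply/mnmP => k; rewrite mnmBE subnn mnm0E.
    by rewrite mderivX mnm1E eqxx scale1r E mmapX mmap11 mul1r addr0.
  by rewrite mderivX mnm1E eq_sym (negbTE ji) scale0r mmap0 mul0r.
have PXm m : P (mpolyX K m).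
  rewrite mpolyXE_id; apply: big_ind => [||i _]; [exact: (PC 1)|exact: PM|].
  by elim: (m i) => [|k IH]; [exact: (PC 1)|rewrite exprS; exact: PM].
elim/mpolyind: f => [|c m f _ _ IH]; first exact: (PC 0).
rewrite -mul_mpolyC rmorphD derivD IH.
have -> := PM _ _ (PC c) (PXm m).
rewrite -big_split /=; apply: eq_bigr => i _.
by rewrite raddfD rmorphD mulrDl.
Qed.

Lemma size_mmap_leq h f : (forall i, (size (h i) <= 2)%N) ->
  (size (mmap polyC h f) <= msize f)%N.
Proof.
move=> sh; rewrite /mmap big_seq.
apply: (big_ind (fun q : {poly K} => size q <= msize f)%N) => [|q r hq hr|m mf].
- by rewrite size_poly0.
- by rewrite (leq_trans (size_polyD _ _)) // geq_max hq.
rewrite mul_polyC (leq_trans (size_scale_leq _ _)) //.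
apply: leq_trans (msize_mdeg_lt mf); rewrite /mmap1 mdegE.
elim/big_rec2: _ => [|i q e _ IH]; first by rewrite size_poly1.
apply: leq_trans (size_polyMleq _ _) _.
have : (size (h i ^+ m i)%R <= (m i).+1)%N.
  elim: (m i) => [|k IHk]; first by rewrite expr0 size_poly1.
  rewrite exprS; apply: leq_trans (size_polyMleq _ _) _.
  have := sh i; lia.
move=> He; rewrite -subn1 leq_subLR add1n -addSn -addnS.
exact: leq_add.
Qed.

Lemma horner_mmap h f t : (mmap polyC h f).[t] = meval (fun i => (h i).[t]) f.
Proof.
rewrite /meval /mmap horner_sum; apply: eq_bigr => m _.
rewrite hornerM hornerC /mmap1 horner_prod.
by congr (_ * _); apply: eq_bigr => i _; rewrite horner_exp.
Qed.

Lemma msize_mderiv i f : (msize (mderiv i f) <= (msize f).-1)%N.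
Proof.
rewrite [X in (X <= _)%N]msizeE; apply/bigmax_leqP_seq => m.
rewrite mcoeff_msupp mcoeff_mderiv => c0 _.
have : mnm_add m (mnm1 i) \in msupp f.
  by rewrite mcoeff_msupp; apply: contraNneq c0 => ->; rewrite mul0rn.
by move/msize_mdeg_lt; rewrite mdegD mdeg1; lia.
Qed.

(** Only exponents divisible by [p] escape differentiation, and the size bound keeps every exponent
    below [p]. *)
Lemma mpolyC_of_mderiv0 (p : nat) f : p \in [pchar K] -> (msize f <= p)%N ->
  (forall i, mderiv i f = 0) -> f = mpolyC n (mcoeff mnm0 f).
Proof.
move=> cK sf d0; apply: msize1_polyC.
rewrite msizeE; apply/bigmax_leqP_seq => m mf _.
rewrite ltnS leqn0 mdeg_eq0; apply/eqP/mnmP => i; rewrite mnm0E.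
apply/eqP; rewrite -leqn0 leqNgt; apply/negP => mi.
have := mf; rewrite mcoeff_msupp => /eqP; apply.
have mip : (m i < p)%N.
  apply: leq_ltn_trans (leq_trans (msize_mdeg_lt mf) sf).
  by rewrite mdegE (bigD1 i) //= leq_addr.
have mE : m = mnm_add (mnm_sub m (mnm1 i)) (mnm1 i).
  apply/mnmP => j; rewrite mnmDE mnmBE mnm1E.
  by case: eqVneq => [<-|_]; rewrite ?subn0 ?addn0 // subnK.
have := congr1 (mcoeff (mnm_sub m (mnm1 i))) (d0 i).
rewrite mcoeff_mderiv -mE mcoeff0 mnmBE mnm1E eqxx subn1 prednK // -mulr_natr.
by move=> /eqP; rewrite mulf_eq0 (negbTE (natf_small_neq0 cK mi mip)) orbF => /eqP.
Qed.
End Substitution.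

(** * Two families of lines in 3-space *)

Definition iX : 'I_3 := @Ordinal 3 0 isT.
Definition iY : 'I_3 := @Ordinal 3 1 isT.
Definition iZ : 'I_3 := @Ordinal 3 2 isT.

Lemma sum3 (V : nmodType) (G : 'I_3 -> V) : \sum_i G i = G iX + G iY + G iZ.
Proof.
rewrite !big_ord_recl big_ord0 addr0 addrA.
by congr (G _ + G _ + G _); apply: val_inj.
Qed.

Section Lines.
Variable K : fieldType.
Implicit Types (f : mpoly 3 K) (x y z a b c : K).

(** The suffix, here and in [lineX], names the coordinate that serves as parameter. *)
Definition lineY x y z : 'I_3 -> {poly K} := tnth [tuple x%:P; 'X; z%:P + y *: 'X].
Definition lineX b a c : 'I_3 -> {poly K} := tnth [tuple 'X; b%:P; c%:P + a *: 'X].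

Lemma size_affine c a : (size (c%:P + a *: 'X : {poly K})%R <= 2)%N.
Proof.
rewrite (leq_trans (size_polyD _ _)) // geq_max (leq_trans (size_polyC_leq1 _)) //.
by rewrite (leq_trans (size_scale_leq _ _)) // size_polyX.
Qed.

Lemma size_lineY x y z i : (size (lineY x y z i) <= 2)%N.
Proof.
case: i => -[|[|[|//]]] ?; rewrite /lineY /tnth /= ?size_polyX ?size_affine //.
by rewrite (leq_trans (size_polyC_leq1 _)).
Qed.

Lemma size_lineX b a c i : (size (lineX b a c i) <= 2)%N.
Proof.
case: i => -[|[|[|//]]] ?; rewrite /lineX /tnth /= ?size_polyX ?size_affine //.
by rewrite (leq_trans (size_polyC_leq1 _)).
Qed.

Lemma deriv_lineY x y z f : (mmap polyC (lineY x y z) f)^`() =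
  mmap polyC (lineY x y z) (mderiv iY f) + y *: mmap polyC (lineY x y z) (mderiv iZ f).
Proof.
rewrite deriv_mmap sum3 /lineY /tnth /= derivC derivX derivD derivC derivZ derivX.
by rewrite mulr0 add0r mulr1 add0r -scalerAr mulr1.
Qed.

Lemma deriv_lineX b a c f : (mmap polyC (lineX b a c) f)^`() =
  mmap polyC (lineX b a c) (mderiv iX f) + a *: mmap polyC (lineX b a c) (mderiv iZ f).
Proof.
rewrite deriv_mmap sum3 /lineX /tnth /= derivC derivX derivD derivC derivZ derivX.
by rewrite mulr0 addr0 mulr1 add0r -scalerAr mulr1.
Qed.

(** The two lines share the point [(x, b, z + y * b)], at parameter [b] on the first and [x] on the
    second. *)
Lemma horner_lines x y z b a c f : z + y * b == c + a * x ->
  (mmap polyC (lineY x y z) f).[b] = (mmap polyC (lineX b a c) f).[x].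
Proof.
move=> /eqP E; rewrite !horner_mmap /meval /mmap; apply: eq_bigr => m _.
congr (_ * _); apply: mmap1_eq => -[[|[|[|//]]] ?]; rewrite /lineX /lineY /tnth /=.
- by rewrite hornerC hornerX.
- by rewrite hornerC hornerX.
- by rewrite !(hornerD, hornerC, hornerZ, hornerX).
Qed.

Lemma poly_eq0_on (I : finType) (x : I -> K) (S : {set I}) (q : {poly K}) :
  injective x -> (size q <= #|S|)%N -> (forall i, i \in S -> q.[x i] = 0) -> q = 0.
Proof.
move=> injx sq q0; apply: (@roots_geq_poly_eq0 _ q [seq x i | i <- enum S]).
- by apply/allP => t /mapP[i]; rewrite mem_enum => iS ->; apply/rootP/q0.
- by rewrite map_inj_uniq ?enum_uniq.
- by rewrite size_map -cardE.
Qed.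

End Lines.

(** * Incidence bound *)

Section BipartiteGraph.
Variables (I1 I2 : finType) (E : I1 -> I2 -> bool).
Implicit Types (S : {set I1}) (T : {set I2}).

Definition edges S T : nat := (\sum_(i in S) \sum_(j in T) E i j)%N.

Lemma edgesC S T : edges S T = (\sum_(j in T) #|[set i in S | E i j]|)%N.
Proof.
rewrite /edges exchange_big; apply: eq_bigr => j _.
by rewrite -sum1_card -big_mkcondr; apply: eq_bigl => i; rewrite !inE.
Qed.

Lemma edgesE S T : edges S T = (\sum_(i in S) #|[set j in T | E i j]|)%N.
Proof.
apply: eq_bigr => i _.
by rewrite -sum1_card -big_mkcondr; apply: eq_bigl => j; rewrite !inE.
Qed.

Lemma edges_setIDl S S' T : edges S T = (edges (S :&: S') T + edges (S :\: S') T)%N.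
Proof. by rewrite /edges (big_setID S'). Qed.

Lemma edges_setIDr S T T' : edges S T = (edges S (T :&: T') + edges S (T :\: T'))%N.
Proof. by rewrite !edgesC (big_setID T'). Qed.

Lemma edges_leq_l S T e : (forall i, i \in S -> #|[set j in T | E i j]| <= e)%N ->
  (edges S T <= e * #|S|)%N.
Proof.
by move=> h; rewrite edgesE mulnC -sum_nat_const; apply: leq_sum => i /h.
Qed.

Lemma edges_leq_r S T e : (forall j, j \in T -> #|[set i in S | E i j]| <= e)%N ->
  (edges S T <= e * #|T|)%N.
Proof.
by move=> h; rewrite edgesC mulnC -sum_nat_const; apply: leq_sum => i /h.
Qed.

(** Delete vertices of degree at most [e] one by one. Each deletion loses at most [e] edges, so the
    strict inequality persists and some edge survives. *)
Lemma min_degree_subgraph e S T : (e * (#|S| + #|T|) < edges S T)%N ->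
  exists S' T', [/\ S' \subset S, T' \subset T, T' != set0,
    forall i, i \in S' -> (e < #|[set j in T' | E i j]|)%N &
    forall j, j \in T' -> (e < #|[set i in S' | E i j]|)%N].
Proof.
have [m] := ubnP (#|S| + #|T|)%N; elim: m S T => // m IH S T hm he.
have [i /andP[iS hi]|hS] := pickP (fun i => (i \in S) && (#|[set j in T | E i j]| <= e)%N).
  have Si : (#|S| = #|S :\ i|.+1)%N by rewrite (cardsD1 i S) iS.
  have [||S' [T' [s1 s2 t0 h1 h2]]] := IH (S :\ i) T; first by lia.
    move: he; rewrite (edgesE S) (big_setD1 i iS) -edgesE /=.
    by rewrite Si addSn mulnS; lia.
  by exists S', T'; split=> //; apply: subset_trans s1 (subsetDl _ _).
have [j /andP[jT hj]|hT] := pickP (fun j => (j \in T) && (#|[set i in S | E i j]| <= e)%N).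
  have Tj : (#|T| = #|T :\ j|.+1)%N by rewrite (cardsD1 j T) jT.
  have [||S' [T' [s1 s2 t0 h1 h2]]] := IH S (T :\ j); first by lia.
    move: he; rewrite (edgesC S) (big_setD1 j jT) -edgesC /=.
    by rewrite Tj addnS mulnS; lia.
  by exists S', T'; split=> //; apply: subset_trans s2 (subsetDl _ _).
exists S, T; split=> // [|i iS|j jT].
- apply/eqP => T0; move: he; rewrite edgesC T0 big_set0; lia.
- by have := hS i; rewrite iS /= => /negbT; rewrite -ltnNge.
- by have := hT j; rewrite jT /= => /negbT; rewrite -ltnNge.
Qed.
End BipartiteGraph.

(** * Surfaces containing many of the lines *)

Section Incidences.
Variables (K : fieldType) (p : nat) (I1 I2 : finType).
Variables (x y z : I1 -> K) (a b c : I2 -> K).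
Hypothesis charK : p \in [pchar K].
Hypotheses (injx : injective x) (injb : injective b).

Definition meets i j : bool := z i + y i * b j == c j + a j * x i.

Local Notation "f |1 i" := (mmap polyC (lineY (x i) (y i) (z i)) f) (at level 10).
Local Notation "f |2 j" := (mmap polyC (lineX (b j) (a j) (c j)) f) (at level 10).
Local Notation dX := (mderiv iX).
Local Notation dY := (mderiv iY).
Local Notation dZ := (mderiv iZ).

(** Intersections with line [j] have distinct abscissae [x i], hence are distinct roots of the
    nonzero restriction of [f]. *)
Lemma few_zeros_l d (f : mpoly 3 K) j (S : {set I1}) :
  (msize f <= d)%N -> f |2 j != 0 ->
  (forall i, i \in S -> (f |1 i).[b j] = 0) ->
  (#|[set i in S | meets i j]| <= d)%N.
Proof.
move=> sf f0 vf; rewrite leqNgt; apply: contra_neqN f0 => h.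
apply: (poly_eq0_on injx (S := [set i in S | meets i j])).
  by apply: leq_trans (ltnW h); apply: leq_trans sf; exact: size_mmap_leq (size_lineX _ _ _).
by move=> i; rewrite inE => /andP[iS m]; rewrite -(horner_lines _ m) vf.
Qed.

Lemma few_zeros_r d (f : mpoly 3 K) i (T : {set I2}) :
  (msize f <= d)%N -> f |1 i != 0 ->
  (forall j, j \in T -> (f |2 j).[x i] = 0) ->
  (#|[set j in T | meets i j]| <= d)%N.
Proof.
move=> sf f0 vf; rewrite leqNgt; apply: contra_neqN f0 => h.
apply: (poly_eq0_on injb (S := [set j in T | meets i j])).
  by apply: leq_trans (ltnW h); apply: leq_trans sf; exact: size_mmap_leq (size_lineY _ _ _).
by move=> j; rewrite inE => /andP[jT m]; rewrite (horner_lines _ m) vf.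
Qed.

(* [- f_Z ^ 3] times the second X-derivative of Z as a function on [f = 0]. *)
Definition hess (f : mpoly 3 K) : mpoly 3 K :=
  dX (dX f) * dZ f * dZ f - dX (dZ f) * dX f * dZ f *+ 2 + dZ (dZ f) * dX f * dX f.

(** Along the line Z is affine in X. Formally, [f_X = - a f_Z] there, and differentiating this along
    the line makes [hess f] cancel. *)
Lemma hess_lineX f j : f |2 j = 0 -> hess f |2 j = 0.
Proof.
move=> f0.
have e1 := deriv_lineX (b j) (a j) (c j) f.
have e2 := deriv_lineX (b j) (a j) (c j) (dX f).
have e3 := deriv_lineX (b j) (a j) (c j) (dZ f).
rewrite f0 deriv0 -mul_polyC in e1.
have fX : dX f |2 j = - ((a j)%:P * dZ f |2 j) by apply/eqP; rewrite -addr_eq0 -e1.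
rewrite fX derivN derivM derivC mul0r add0r e3 -!mul_polyC (mderiv_comm iX iZ) in e2.
have fXX : dX (dX f) |2 j = - ((a j)%:P * (dX (dZ f) |2 j + (a j)%:P * dZ (dZ f) |2 j))
   - (a j)%:P * dX (dZ f) |2 j.
  by rewrite e2 addrK.
by rewrite /hess !(mmapD, mmapN, mmapMn, rmorphM) /= fXX fX; ring.
Qed.

(* On an X-line [m] of the surface [f = 0], this is [M ^ 4] times the second
   derivative along [m] of [N / M], where [N] and [M] are the restrictions to
   [m] of [f_Y] and [f_Z]. *)
Lemma hess_deriv_lineX f j : f |2 j = 0 ->
  let N := dY f |2 j in let M := dZ f |2 j in
  (dZ f * dY (hess f) - dY f * dZ (hess f)) |2 j =
  M * (M ^+ 2 * N^`()^`() - 2%:R * M * M^`() * N^`() - N * M * M^`()^`()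
    + 2%:R * N * M^`() ^+ 2).
Proof.
move=> f0 N M.
(* Each X-derivative is traded for the derivative along the line minus [a j] times a
   Z-derivative. *)
have D g : (g |2 j)^`() = dX g |2 j + (a j)%:P * dZ g |2 j.
  by rewrite deriv_lineX mul_polyC.
have fX : dX f |2 j = - ((a j)%:P * M).
  by apply/eqP; rewrite -addr_eq0 -D f0 deriv0.
have M' : dX (dZ f) |2 j = M^`() - (a j)%:P * dZ (dZ f) |2 j.
  by rewrite /M D addrK.
have N' : dX (dY f) |2 j = N^`() - (a j)%:P * dY (dZ f) |2 j.
  by rewrite /N D (mderiv_comm iY iZ) addrK.
have fXX : dX (dX f) |2 j = - ((a j)%:P * M^`()) - (a j)%:P * dX (dZ f) |2 j.
  rewrite -[dX (dX f) |2 j](addrK ((a j)%:P * dZ (dX f) |2 j)) -D fX.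
  by rewrite derivN derivM derivC mul0r add0r (mderiv_comm iX iZ).
have M'' : dX (dX (dZ f)) |2 j = M^`()^`() - 2%:R * (a j)%:P * dX (dZ (dZ f)) |2 j
    - (a j)%:P ^+ 2 * dZ (dZ (dZ f)) |2 j.
  rewrite /M !(D, derivD, derivM, derivC) (mderiv_comm iX iZ); ring.
have N'' : dX (dX (dY f)) |2 j = N^`()^`() - 2%:R * (a j)%:P * dX (dY (dZ f)) |2 j
    - (a j)%:P ^+ 2 * dY (dZ (dZ f)) |2 j.
  rewrite /N !(D, derivD, derivM, derivC) (mderiv_comm iX iZ) !(mderiv_comm iY iZ); ring.
rewrite /hess !(mderivD, mderivN, mderivM, mderivMn)
  !(mderiv_comm iX iZ, mderiv_comm iX iY, mderiv_comm iY iZ).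
have rM g h : (g * h) |2 j = g |2 j * h |2 j by exact: rmorphM.
rewrite !(mmapD, mmapN, mmapMn, rM).
by rewrite -/N -/M N'' M'' fXX N' M' fX; ring.
Qed.

(** Where line [i] crosses line [j0] and [f_Z] is nonzero, the slope [y i] equals [- f_Y / f_Z],
    which turns out to be affine along line [j0]. The term [d] pays for the zeros of [f_Z]. *)
Lemma rich_lines_collinear d (f : mpoly 3 K) (S : {set I1}) (T : {set I2}) j0 :
  (msize f <= d.+1)%N -> (d + d <= p)%N ->
  (forall i, i \in S -> f |1 i = 0) -> (forall j, j \in T -> f |2 j = 0) ->
  (forall i, i \in S -> 4 * d < #|[set j in T | meets i j]|)%N ->
  j0 \in T -> (4 * d < #|[set i in S | meets i j0]|)%N -> dZ f |2 j0 != 0 ->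
  exists e g : K,
  (#|[set i in S | meets i j0]| <= #|[set i | meets i j0 & (y i == e + g * x i)%R]| + d)%N.
Proof.
move=> sf dp vS vT degS j0T deg0 M0.
set N := dY f |2 j0; set M := dZ f |2 j0.
have sdf i : (msize (mderiv i f) <= d)%N.
  by apply: leq_trans (msize_mderiv _ _) _; move: sf; case: (msize f).
have sd2f i i' : (msize (mderiv i (mderiv i' f)) <= d)%N.
  by apply: leq_trans (msize_mderiv _ _) _; apply: leq_trans (leq_pred _) (sdf _).
have s1 i g : (msize g <= d)%N -> (size (g |1 i) <= d)%N.
  by apply: leq_trans; apply: size_mmap_leq; exact: size_lineY.
have s2 j g : (msize g <= d)%N -> (size (g |2 j) <= d)%N.
  by apply: leq_trans; apply: size_mmap_leq; exact: size_lineX.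
have s3 (q r s : {poly K}) : (size q <= d -> size r <= d -> size s <= d ->
    size (q * r * s)%R <= 3 * d)%N.
  move=> h1 h2 h3; apply: leq_trans (size_polyMleq _ _) _.
  by have := size_polyMleq q r; lia.
have sA (q r : {poly K}) n : (size q <= n -> size r <= n -> size (q + r)%R <= n)%N.
  by move=> h1 h2; rewrite (leq_trans (size_polyD _ _)) // geq_max h1.
have sN (q : {poly K}) n : (size q <= n -> size (- q)%R <= n)%N by rewrite size_polyN.
(* [hess f] is a sum of triple products of derivatives, so its restriction has size at most [3 * d],
   while it vanishes at more than [4 * d] points. *)
have hessS i : i \in S -> hess f |1 i = 0.
  move=> iS; apply: (poly_eq0_on injb (S := [set j in T | meets i j])).
    apply: leq_trans (_ : 3 * d <= _)%N; last by have := degS _ iS; lia.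
    have rM g h : (g * h) |1 i = g |1 i * h |1 i by exact: rmorphM.
    rewrite /hess !(mmapD, mmapN, rM).
    by repeat first [apply/sA | apply/sN | apply/s3]; apply/s1.
  move=> j; rewrite inE => /andP[jT m].
  by rewrite (horner_lines _ m) hess_lineX ?vT // horner0.
(* Since [f] and [hess f] vanish along each line [i], their (Y, Z)-gradients are both orthogonal to
   [(1, y i)], so this determinant is zero at every crossing. On line [j0] it is [M] times a
   triple-product sum, of size at most [4 * d]. *)
have J0 : (dZ f * dY (hess f) - dY f * dZ (hess f)) |2 j0 = 0.
  apply: (poly_eq0_on injx (S := [set i in S | meets i j0])).
    apply: leq_trans (ltnW deg0); rewrite hess_deriv_lineX ?vT //.
    rewrite (leq_trans (size_polyMleq _ _)) //.
    have s4 : (size (M ^+ 2 * N^`()^`() - 2%:R * M * M^`() * N^`() - N * M * M^`()^`()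
        + 2%:R * N * M^`() ^+ 2)%R <= 3 * d)%N.
      have NS : (size N <= d)%N := s2 j0 _ (sdf iY).
      have MS : (size M <= d)%N := s2 j0 _ (sdf iZ).
      have sD (q : {poly K}) : (size q <= d)%N -> (size q^`() <= d)%N.
        have [->|q0 h] := eqVneq q 0; first by rewrite deriv0 size_poly0.
        exact: leq_trans (ltnW (lt_size_deriv q0)) h.
      rewrite (_ : _ + _ = M * M * N^`()^`() - (M * M^`() * N^`() + M * M^`() * N^`())
          - N * M * M^`()^`() + (N * M^`() * M^`() + N * M^`() * M^`())); last by ring.
      by repeat first [apply/sA | apply/sN | apply/s3]; rewrite ?sD.
    rewrite (leq_trans (leq_pred _)) // (leq_trans (leq_add (s2 j0 _ (sdf iZ)) s4)) //.
  move=> i; rewrite inE => /andP[iS m].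
  rewrite -(horner_lines _ m) !(mmapD, mmapN, rmorphM) /=.
  have := deriv_lineY (x i) (y i) (z i) f.
  have := deriv_lineY (x i) (y i) (z i) (hess f).
  rewrite vS // hessS // deriv0 => /esym/eqP; rewrite addr_eq0 => /eqP ->.
  move=> /esym/eqP; rewrite addr_eq0 => /eqP ->.
  rewrite -!mul_polyC [X in X.[_]](_ : _ = 0) ?horner0 //; ring.
have [|e [g NE]] := linear_quotient charK dp (s2 j0 _ (sdf iY)) (s2 j0 _ (sdf iZ)) M0.
  move/eqP: J0; rewrite hess_deriv_lineX ?vT // mulf_eq0 (negbTE M0) /=.
  by move/eqP.
exists (- e), (- g).
pose S0 := [set i in S | (dZ f |1 i).[b j0] == 0].
have S0d : (#|[set i in S0 | meets i j0]| <= d)%N.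
  by apply: (few_zeros_l (sdf iZ) M0) => i; rewrite inE => /andP[_ /eqP].
apply: leq_trans (leq_add (leqnn _) S0d).
rewrite -cardsUI (leq_trans _ (leq_addr _ _)) //.
apply/subset_leq_card/subsetP => i; rewrite !inE => /andP[iS m].
rewrite m iS !andbT /=; have [_|Mi0] := eqVneq ((dZ f |1 i).[b j0]) 0; rewrite ?orbT ?orbF //.
have := deriv_lineY (x i) (y i) (z i) f; rewrite vS // deriv0.
move/(congr1 (fun q : {poly K} => q.[b j0])).
rewrite horner0 hornerD hornerZ !(horner_lines _ m) NE hornerM -mulrDl => /esym/eqP.
rewrite mulf_eq0 (horner_lines _ m) in Mi0 *.
rewrite (negbTE Mi0) orbF hornerD hornerC hornerZ hornerX addrC addr_eq0.
by move=> /eqP ->; rewrite opprD mulNr.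
Qed.

(** Induction on the degree bound: the lines on which a nonzero partial derivative of [f] vanishes
    fall under the induction hypothesis for that derivative. *)
Lemma edges_on_surface k :
  (forall j e g, #|[set i | meets i j & (y i == e + g * x i)%R]| <= k)%N ->
  forall d (f : mpoly 3 K) (S : {set I1}) (T : {set I2}),
  f != 0 -> (msize f <= d.+1)%N -> (d + d <= p)%N ->
  (forall i, i \in S -> f |1 i = 0) -> (forall j, j \in T -> f |2 j = 0) ->
  (edges meets S T <= (5 * d + k) * (#|S| + #|T|))%N.
Proof.
move=> col; elim=> [|d IH] f S T f0 sf dp vS vT.
  have fE := msize1_polyC sf.
  have c0 : mcoeff mnm0 f != 0 by apply: contraNneq f0 => c0; rewrite fE c0 mpolyC0.
  have S0 i : i \in S = false.
    apply/negP => /vS; rewrite fE mmapC => /eqP; rewrite polyC_eq0; exact/negP.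
  by rewrite /edges big_pred0.
have sdf i : (msize (mderiv i f) <= d.+1)%N.
  by apply: leq_trans (msize_mderiv _ _) _; move: sf; case: (msize f).
have dp' : (d + d <= p)%N by lia.
have [fZ0|fZ0] := eqVneq (dZ f) 0; last first.
  rewrite leqNgt; apply/negP => big.
  pose A := [set i | dZ f |1 i == 0]; pose B := [set j | dZ f |2 j == 0].
  have h1 : (edges meets (S :&: A) (T :&: B) <= (5 * d + k) * (#|S :&: A| + #|T :&: B|))%N.
    by apply: (IH (dZ f)) => // [i|j]; rewrite !inE => /andP[_ /eqP].
  have h2 : (edges meets (S :&: A) (T :\: B) <= d.+1 * #|T :\: B|)%N.
    apply: edges_leq_r => j; rewrite !inE => /andP[nj _].
    apply: (few_zeros_l (sdf iZ) nj) => i; rewrite !inE => /andP[_ /eqP ->].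
    by rewrite horner0.
  have h3 : (edges meets (S :\: A) (T :&: B) <= d.+1 * #|S :\: A|)%N.
    apply: edges_leq_l => i; rewrite !inE => /andP[ni _].
    apply: (few_zeros_r (sdf iZ) ni) => j; rewrite !inE => /andP[_ /eqP ->].
    by rewrite horner0.
  have := cardsID A S; have := cardsID B T => cT cS.
  (* The three bounds leave more than [4 * d.+1 + k] edges per line among the lines where [f_Z] is
     not identically zero. Such a degree exceeds the [k] collinear points plus [d.+1] exceptions. *)
  have [|S' [T' [sS sT T0 dS dT]]] :=
      @min_degree_subgraph _ _ meets (4 * d.+1 + k) (S :\: A) (T :\: B).
    move: big; rewrite (edges_setIDl _ _ A) !(edges_setIDr _ _ T B) -cS -cT.
    move: h1 h2 h3; set e1 := edges _ _ _; set e2 := edges _ _ _.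
    set e3 := edges _ _ _; set e4 := edges _ _ _; nia.
  have [j0 j0T] := set0Pn _ T0.
  have [||||||||e [g h]] := @rich_lines_collinear d.+1 f S' T' j0; rewrite //.
  - by move=> i /(subsetP sS); rewrite inE => /andP[_ /vS].
  - by move=> j /(subsetP sT); rewrite inE => /andP[_ /vT].
  - by move=> i /dS; lia.
  - by have := dT _ j0T; lia.
  - by have := subsetP sT _ j0T; rewrite !inE => /andP[].
  - have := leq_trans (dT _ j0T) (leq_trans h (leq_add (col j0 e g) (leqnn _))).
    lia.
(* With [f_Z = 0], differentiation along the second family shows that [f_X] vanishes on it, so only
   the first family is split. *)
have [fX0|fX0] := eqVneq (dX f) 0; last first.
  pose A := [set i | dX f |1 i == 0].
  have v2 j : j \in T -> dX f |2 j = 0.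
    move=> jT; have := deriv_lineX (b j) (a j) (c j) f.
    by rewrite vT // deriv0 fZ0 mmap0 scaler0 addr0.
  have h1 : (edges meets (S :&: A) T <= (5 * d + k) * (#|S :&: A| + #|T|))%N.
    by apply: (IH (dX f)) => // i; rewrite !inE => /andP[_ /eqP].
  have h2 : (edges meets (S :\: A) T <= d.+1 * #|S :\: A|)%N.
    apply: edges_leq_l => i; rewrite !inE => /andP[ni _].
    by apply: (few_zeros_r (sdf iX) ni) => j /v2 ->; rewrite horner0.
  rewrite (edges_setIDl _ _ A) -(cardsID A S); move: h1 h2.
  by set e1 := edges _ _ _; set e2 := edges _ _ _; nia.
have [fY0|fY0] := eqVneq (dY f) 0; last first.
  pose B := [set j | dY f |2 j == 0].
  have v1 i : i \in S -> dY f |1 i = 0.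
    move=> iS; have := deriv_lineY (x i) (y i) (z i) f.
    by rewrite vS // deriv0 fZ0 mmap0 scaler0 addr0.
  have h1 : (edges meets S (T :&: B) <= (5 * d + k) * (#|S| + #|T :&: B|))%N.
    by apply: (IH (dY f)) => // i; rewrite !inE => /andP[_ /eqP].
  have h2 : (edges meets S (T :\: B) <= d.+1 * #|T :\: B|)%N.
    apply: edges_leq_r => j; rewrite !inE => /andP[nj _].
    by apply: (few_zeros_l (sdf iY) nj) => i /v1 ->; rewrite horner0.
  rewrite (edges_setIDr _ _ T B) -(cardsID B T); move: h1 h2.
  by set e1 := edges _ _ _; set e2 := edges _ _ _; nia.
have fE : f = mpolyC 3 (mcoeff mnm0 f).
  apply: (mpolyC_of_mderiv0 charK) => [|[[|[|[|//]]] hi]]; first by lia.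
  - by rewrite -[RHS]fX0; congr (mderiv _ _); apply: val_inj.
  - by rewrite -[RHS]fY0; congr (mderiv _ _); apply: val_inj.
  - by rewrite -[RHS]fZ0; congr (mderiv _ _); apply: val_inj.
have : (msize f <= d.+1)%N.
  by rewrite fE msizeC; case: eqP.
by move=> h; apply: leq_trans (IH f S T f0 h dp' vS vT) _; rewrite leq_mul2r; apply/orP; right; lia.
Qed.

(** Dimension count: [m.+1 ^ 3] monomials with exponents at most [m], against [3 * m + 1] linear
    conditions per line. *)
Lemma exists_surface m : (3 * #|I1| <= m.+1 ^ 2)%N ->
  exists f : mpoly 3 K, [/\ f != 0, (msize f <= (3 * m).+1)%N & forall i, f |1 i = 0].
Proof.
move=> hm.
pose mon (t : 'I_m.+1 * 'I_m.+1 * 'I_m.+1) : multinom 3 :=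
  Multinom [tuple (t.1.1 : nat); (t.1.2 : nat); (t.2 : nat)].
have mon_inj : injective mon.
  move=> [[u1 u2] u3] [[w1 w2] w3] E; have H i : mon (u1,u2,u3) i = mon (w1,w2,w3) i by rewrite E.
  have := (H iX, H iY, H iZ); rewrite /mon !multinomE /tnth /= => -[[h1 h2] h3].
  by congr (_, _, _); apply: val_inj.
pose L (u : I1 * 'I_(3 * m).+1) t := (mpolyX K (mon t) |1 u.1)`_u.2.
pose A := \matrix_(t < #|{: 'I_m.+1 * 'I_m.+1 * 'I_m.+1}|, u < #|{: I1 * 'I_(3 * m).+1}|)
  L (enum_val u) (enum_val t).
have : kermx A != 0.
  rewrite kermx_eq0 /row_free neq_ltn; apply/orP; left.
  apply: leq_ltn_trans (rank_leq_col _) _.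
  by rewrite !card_prod !card_ord; nia.
case/rowV0Pn => v /sub_kermxP vA v0.
pose f := \sum_t v 0 (enum_rank t) *: mpolyX K (mon t).
have fc t : mcoeff (mon t) f = v 0 (enum_rank t).
  rewrite raddf_sum (bigD1 t) //= big1 ?addr0 => [|u ut].
    by rewrite mcoeffZ mcoeffX eqxx mulr1.
  by rewrite mcoeffZ mcoeffX (inj_eq mon_inj) (negbTE ut) mulr0.
have sf : (msize f <= (3 * m).+1)%N.
  apply: leq_trans (msize_sum _ _ _) _; apply/bigmax_leqP => t _.
  apply: leq_trans (msizeZ_le _ _) _; rewrite msizeX ltnS mdegE sum3 /mon !multinomE /tnth /=.
  have := (ltn_ord t.1.1, ltn_ord t.1.2, ltn_ord t.2).
  by move: (t.1.1 : nat) (t.1.2 : nat) (t.2 : nat) => q1 q2 q3 [[]]; lia.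
exists f; split=> // [|i].
  apply: contraNneq v0 => f0; apply/eqP/rowP => t.
  by rewrite -(enum_valK t) -fc f0 mcoeff0 mxE.
apply/polyP => l; rewrite coef0; have [hl|hl] := ltnP l (3 * m).+1; last first.
  rewrite nth_default // (leq_trans _ hl) // (leq_trans _ sf) //.
  exact/size_mmap_leq/size_lineY.
have := congr1 (fun w : 'rV_ _ => w 0 (enum_rank (i, Ordinal hl))) vA.
rewrite [LHS]mxE [RHS]mxE => vA0; apply: etrans vA0; rewrite /f raddf_sum /= coef_sum.
rewrite (reindex (@enum_val _ (mem {: 'I_m.+1 * 'I_m.+1 * 'I_m.+1}))) /=; last first.
  by apply: onW_bij; exact: enum_val_bij.
by apply: eq_bigr => t _; rewrite !mxE enum_rankK enum_valK mmapZ mul_polyC coefZ.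
Qed.

(** Lines of the second family inside a surface of degree at most [3 * m] through the first family
    are covered by [edges_on_surface]; each other line has at most [3 * m + 1] intersections. *)
Lemma incidence_bound k m :
  (forall j e g, #|[set i | meets i j & (y i == e + g * x i)%R]| <= k)%N ->
  (3 * #|I1| <= m.+1 ^ 2)%N -> (6 * m <= p)%N ->
  (edges meets setT setT <= (15 * m + k) * (#|I1| + #|I2|) + (3 * m).+1 * #|I2|)%N.
Proof.
move=> col hm mp; have [f [f0 sf v1]] := exists_surface hm.
pose B := [set j | f |2 j == 0].
rewrite (edges_setIDr _ _ setT B); apply: leq_add.
  apply: leq_trans (edges_on_surface col f0 sf _ _ _) _ => // [|j|].
  - by lia.
  - by rewrite inE => /andP[_]; rewrite inE => /eqP.
  by rewrite mulnA leq_mul2l leq_add ?orbT // ?cardsT ?max_card.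
apply: leq_trans (_ : (3 * m).+1 * #|setT :\: B| <= _)%N.
  apply: edges_leq_r => j; rewrite !inE andbT => nj.
  by apply: (few_zeros_l sf nj) => i _; rewrite v1 horner0.
by rewrite leq_mul2l max_card orbT.
Qed.
End Incidences.

(** * Energy of shifted products *)

Lemma sum_sqr_leq (I : finType) (r : I -> nat) :
  ((\sum_i r i) ^ 2 <= #|I| * \sum_i r i ^ 2)%N.
Proof.
rewrite -(leq_pmul2l (ltn0Sn 1)).
have -> : (2 * (\sum_i r i) ^ 2 = \sum_i \sum_j 2 * (r i * r j))%N.
  rewrite -mulnn big_distrl big_distrr /=; apply: eq_bigr => i _.
  by rewrite big_distrr big_distrr.
apply: (@leq_trans (\sum_i \sum_j (r i ^ 2 + r j ^ 2))%N).
  by apply: leq_sum => i _; apply: leq_sum => j _; exact: nat_Cauchy.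
rewrite (eq_bigr (fun i => #|I| * r i ^ 2 + \sum_j r j ^ 2)%N) => [|i _].
  by rewrite big_split /= sum_nat_const -big_distrr /= mul2n addnn.
by rewrite big_split /= sum_nat_const.
Qed.

(** Makes the variable of [F(t)] usable as the generic parameter: degree 3 is what cross-multiplying
    the coordinates below produces. *)
Lemma tofrac_cubic_inj (F : fieldType) (u0 u1 u2 u3 w0 w1 w2 w3 : F) :
  let io := (@tofrac {poly F} \o polyC) in let t := tofrac 'X in
  io u0 + io u1 * t + io u2 * t ^+ 2 + io u3 * t ^+ 3 =
  io w0 + io w1 * t + io w2 * t ^+ 2 + io w3 * t ^+ 3 ->
  [/\ u0 = w0, u1 = w1, u2 = w2 & u3 = w3].
Proof.
move=> io t; rewrite /io /t /= -!rmorphXn -!rmorphM -!rmorphD => /eqP.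
rewrite tofrac_eq => /eqP E.
have C k := congr1 (fun q : {poly F} => q`_k) E.
have := (C 0%N, C 1%N, C 2, C 3); rewrite !coefD !coefCM !coefC !coefX !coefXn /=.
by rewrite !(mulr0, mulr1, addr0, add0r) => -[[[]]].
Qed.

Section Energy.
Variables (F K : fieldType) (p : nat) (io : {rmorphism F -> K}) (t : K).
Hypothesis charF : p \in [pchar F].
Hypothesis t_cubic : forall u0 u1 u2 u3 w0 w1 w2 w3 : F,
  io u0 + io u1 * t + io u2 * t ^+ 2 + io u3 * t ^+ 3 =
  io w0 + io w1 * t + io w2 * t ^+ 2 + io w3 * t ^+ 3 ->
  [/\ u0 = w0, u1 = w1, u2 = w2 & u3 = w3].
Variables (TP TA TV : finType) (P : TP -> F) (A : TA -> F) (V : TV -> F) (al : F).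
Hypotheses (injP : injective P) (injA : injective A) (injV : injective V).
Hypotheses (A0 : forall x, A x != 0) (V0 : forall v, V v != 0) (al0 : al != 0).

(* The equation [x1 (al + p1 v1) = x2 (al + p2 v2)] is an incidence between the
   point [(p1, x2, v2)] and the plane [(p2, x1, v1)]; both are indexed by the
   same type.  The coordinates below come from a projective frame in general
   position, as witnessed by the transcendental [t]. *)
Local Notation I := (TP * TA * TV)%type.

Let den (i : I) : K := 1 + t * io (P i.1.1).
Let X (i : I) : K := io (A i.1.2) * (1 + t ^+ 2 * io (V i.2)) / den i.
Let Y (i : I) : K := - io (P i.1.1) / den i.
Let Z (i : I) : K := io (V i.2) * io (A i.1.2) / den i.
Let den' (j : I) : K := io (P j.1.1) - io al * t ^+ 2.
Let B (j : I) : K := io (A j.1.2) * (io (V j.2) - io al * t) / den' j.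
Let slope (j : I) : K := - io al / den' j.
Let C (j : I) : K := io al * io (A j.1.2) / den' j.

Let den0 i : den i != 0.
Proof.
apply/eqP => E; have := @t_cubic 1 (P i.1.1) 0 0 0 0 0 0.
rewrite !rmorph0 rmorph1 !mul0r !addr0 mulrC => /(_ E) [] /eqP.
by rewrite oner_eq0.
Qed.

Let den'0 j : den' j != 0.
Proof.
apply/eqP => E; have := @t_cubic (P j.1.1) 0 (- al) 0 0 0 0 0.
rewrite !rmorph0 rmorphN !mul0r !addr0 mulNr => /(_ E) [] _ _ /eqP.
by rewrite oppr_eq0 (negbTE al0).
Qed.

Let injX : injective X.
Proof.
move=> [[q x] v] [[q' x'] v']; rewrite /X => /eqP; rewrite eqr_div // => /eqP E.
(* The coefficients of 1, [t] and [t ^+ 2] recover [x], [q] and [v] in turn. *)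
have := @t_cubic (A x) (A x * P q') (A x * V v) (A x * V v * P q')
                 (A x') (A x' * P q) (A x' * V v') (A x' * V v' * P q).
rewrite !rmorphM; case.
  by apply: etrans (etrans _ E) _; rewrite /den /=; ring.
move=> {E} /injA <-{x'} /(mulfI (A0 _)) /injP -> /(mulfI (A0 _)) /injV -> _ //.
Qed.

Let injB : injective B.
Proof.
move=> [[q x] v] [[q' x'] v']; rewrite /B => /eqP; rewrite eqr_div // => /eqP E.
have := @t_cubic (A x * V v * P q') (- (A x * al * P q')) (- (A x * al * V v)) (A x * al ^+ 2)
                 (A x' * V v' * P q) (- (A x' * al * P q)) (- (A x' * al * V v')) (A x' * al ^+ 2).
rewrite !(rmorphN, rmorphM, rmorphXn); case.
  by apply: etrans (etrans _ E) _; rewrite /den' /=; ring.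
have al2 : al ^+ 2 != 0 by rewrite expf_neq0.
move=> {E} _ h1 h2 /(mulIf al2) /injA Ex; move: h1 h2; rewrite -Ex.
move=> /oppr_inj /(mulfI (mulf_neq0 (A0 _) al0)) /injP ->.
by move=> /oppr_inj /(mulfI (mulf_neq0 (A0 _) al0)) /injV ->.
Qed.

(** The frame disappears on clearing denominators: the two sides of [meets] differ by a nonzero
    multiple of the difference in the energy equation. *)
Let meetsE i j : meets X Y Z slope B C i j =
  (A j.1.2 * (al + P i.1.1 * V j.2) == A i.1.2 * (al + P j.1.1 * V i.2)).
Proof.
rewrite -(inj_eq (fmorph_inj io)) !(rmorphM, rmorphD) /= /meets.
rewrite -subr_eq0 -[RHS]subr_eq0.
have -> : Z i + Y i * B j - (C j + slope j * X i) =
   - (io (A j.1.2) * (io al + io (P i.1.1) * io (V j.2)) -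
    io (A i.1.2) * (io al + io (P j.1.1) * io (V i.2))) / (den i * den' j).
  have := den0 i; have := den'0 j; rewrite /X /Y /Z /B /C /slope /den /den' => h1 h2.
  by field; rewrite h1 h2.
by rewrite mulf_eq0 oppr_eq0 invr_eq0 mulf_eq0 (negbTE (den0 i)) (negbTE (den'0 j)) !orbF.
Qed.

(** Eliminating [P i.1.1] from the two conditions leaves a nontrivial relation [A (r + s V) = u]. It
    fixes [V] or lets [V] determine [A]; the incidence then determines [P]. *)
Let collinear_bound j (e g : K) :
  (#|[set i | meets X Y Z slope B C i j & (Y i == e + g * X i)%R]| <= maxn #|TA| #|TV|)%N.
Proof.
set S := [set i | _ & _].
pose E := 1 + t * e; pose w := io (A j.1.2) * io (V j.2).
have w0 : w != 0 by rewrite /w -rmorphM fmorph_eq0 mulf_neq0.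
pose r := E * io al + w * g.
pose s := E * io (P j.1.1) + w * g * t ^+ 2.
pose u := E * io al * io (A j.1.2) - w * e.
have line i : i \in S -> io (A i.1.2) * (r + s * io (V i.2)) = u.
  rewrite inE meetsE => /andP[/eqP/(congr1 io) m /eqP y].
  have {}y : - io (P i.1.1) = e * den i + g * (io (A i.1.2) * (1 + t ^+ 2 * io (V i.2))).
    have Yd : Y i * den i = - io (P i.1.1) by rewrite /Y divfK.
    have Xd : X i * den i = io (A i.1.2) * (1 + t ^+ 2 * io (V i.2)) by rewrite /X divfK.
    by rewrite -Yd y mulrDl -mulrA Xd.
  rewrite !(rmorphM, rmorphD) in m.
  apply/eqP; rewrite -subr_eq0; apply/eqP.
  rewrite -[LHS]subr0 -[X in _ - X](_ : E * (io (A i.1.2) * (io al + io (P j.1.1) * io (V i.2)) -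
     io (A j.1.2) * (io al + io (P i.1.1) * io (V j.2)))
     + w * (e * den i + g * (io (A i.1.2) * (1 + t ^+ 2 * io (V i.2))) - - io (P i.1.1)) = 0).
    by rewrite /u /r /s /E /w /den; ring.
  by rewrite m y !subrr !mulr0 addr0.
have inj2 i i' : i \in S -> i' \in S -> i.1.2 = i'.1.2 -> i.2 = i'.2 -> i = i'.
  case: i => [[q x] v]; case: i' => [[q' x'] v']; rewrite !inE !meetsE /=.
  move=> /andP[/eqP m _] /andP[/eqP m' _] Ex Ev; rewrite -Ex -Ev in m' *.
  move: m; rewrite -m' => /(mulfI (A0 _)) /addrI /(mulIf (V0 _)) /injP ->.
  by [].
(* If all three vanish, [s - t ^+ 2 * r = E * den' j] forces [E = 0], then [g = 0] and [e = 0],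
   contradicting [E = 1 + t * e]. *)
have nz : [|| r != 0, s != 0 | u != 0].
  apply: contraT; rewrite !negb_or !negbK => /and3P[/eqP r0 /eqP s0 /eqP u0].
  have E0 : E = 0.
    apply/eqP; have := mulf_eq0 E (den' j); rewrite (negbTE (den'0 j)) orbF => <-.
    apply/eqP; rewrite -s0 /den' -[LHS]addr0 -(mul0r (t ^+ 2)) -r0 /s /r; ring.
  have g0 : g = 0.
    by move/eqP: r0; rewrite /r E0 mul0r add0r mulf_eq0 (negbTE w0) => /eqP.
  have e0 : e = 0.
    by move/eqP: u0; rewrite /u E0 !mul0r sub0r oppr_eq0 mulf_eq0 (negbTE w0) => /eqP.
  by move/eqP: E0; rewrite /E e0 mulr0 addr0 oner_eq0.
have [u0|u0] := eqVneq u 0.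
  have s0 i : i \in S -> r + s * io (V i.2) = 0.
    move/line/eqP; rewrite u0 mulf_eq0 fmorph_eq0 (negbTE (A0 _)) => /eqP //.
  apply: leq_trans (leq_maxl _ _).
  rewrite -(card_in_imset (f := fun i : I => i.1.2)) ?max_card // => i i' iS iS' Ex.
  apply: inj2 => //; have := s0 _ iS; rewrite -(s0 _ iS') => /addrI.
  have sn0 : s != 0.
    apply: contraTneq nz => sz; rewrite sz u0 eqxx !orbF negbK.
    by have := s0 _ iS; rewrite sz mul0r addr0 => ->.
  by move/(mulfI sn0)/fmorph_inj/injV.
apply: leq_trans (leq_maxr _ _).
rewrite -(card_in_imset (f := fun i : I => i.2)) ?max_card // => i i' iS iS' Ev.
apply: inj2 => //; have := line _ iS; rewrite -(line _ iS') Ev => h.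
apply/injA/(fmorph_inj io)/(mulIf _ h).
by apply: contraNneq u0 => z; rewrite -(line _ iS') z mulr0.
Qed.

Definition energy : nat :=
  #|[set u : I * I | A u.1.1.2 * (al + P u.1.1.1 * V u.1.2) ==
                     A u.2.1.2 * (al + P u.2.1.1 * V u.2.2)]|.

(** Exchanging the A- and V-entries of the two triples injects solutions into incidences. With both
    families of the same size, 33 is 2 * 15 + 3. *)
Lemma energy_bound m : (3 * (#|TP| * #|TA| * #|TV|) <= m.+1 ^ 2)%N -> (6 * m <= p)%N ->
  (energy <= #|TP| * #|TA| * #|TV| * (33 * m + 2 * maxn #|TA| #|TV| + 1))%N.
Proof.
move=> hm mp.
have charK : p \in [pchar K] by rewrite (fmorph_pchar io).
have cI : #|{: I}| = (#|TP| * #|TA| * #|TV|)%N by rewrite !card_prod.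
have := @incidence_bound K p I I X Y Z slope B C charK injX injB (maxn #|TA| #|TV|) m collinear_bound.
rewrite cI => /(_ hm mp) h.
apply: (@leq_trans (edges (meets X Y Z slope B C) setT setT)); last first.
  by apply: leq_trans h _; set n := (_ * _ * _)%N; nia.
pose h2 (u : I * I) : I * I := ((u.1.1.1, u.2.1.2, u.2.2), (u.2.1.1, u.1.1.2, u.1.2)).
have h2I : injective h2.
  by move=> [[[q x] v] [[q' x'] v']] [[[q1 x1] v1] [[q1' x1'] v1']] [] -> -> -> -> -> ->.
rewrite /energy -(card_imset _ h2I) /edges pair_big /= -sum1_card big_mkcond /=.
rewrite [X in (_ <= X)%N](eq_bigl xpredT); last by move=> u; rewrite !inE.
apply: leq_sum => w _; case: imsetP => // -[u]; rewrite inE => hu ->.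
by rewrite meetsE /= hu.
Qed.

(** Taking [P q = A a / V v] gives [A c * (al + P q * V v) = A c * (al + A a)], a value of [P]. This
    yields [#|TA| ^ 2 * #|TV|] triples, and Cauchy-Schwarz applies to the fibres [R w]. *)
Lemma energy_lower :
  (forall a v, exists q, P q * V v = A a) -> (forall c a, exists q, P q = A c * (al + A a)) ->
  ((#|TA| ^ 2 * #|TV|) ^ 2 <= #|TP| * energy)%N.
Proof.
move=> PV PA.
pose phi (i : I) := A i.1.2 * (al + P i.1.1 * V i.2).
pose R w := [set i : I | phi i == P w].
have sumR : (#|TA| ^ 2 * #|TV| <= \sum_w #|R w|)%N.
  have /fin_all_exists[f fE] : forall u : TA * TV, exists q, P q * V u.2 = A u.1 by move=> u; exact: PV.
  pose h (u : TA * TA * TV) : I := (f (u.1.2, u.2), u.1.1, u.2).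
  have hI : injective h.
    move=> [[c a] v] [[c' a'] v'] [] E -> Ev; congr (_, _, _) => //.
    by apply: injA; rewrite -(fE (a, v)) -(fE (a', v')) E Ev.
  rewrite -mulnn -!card_prod -cardsT -(card_imset _ hI).
  apply: (@leq_trans #|\bigcup_w R w|); last first.
    elim/big_rec2: _ => [|w k S _ IH]; first by rewrite cards0.
    by rewrite (leq_trans (leq_card_setU _ _)) // leq_add2l.
  apply/subset_leq_card/subsetP => _ /imsetP[[[c a] v] _ ->].
  have [q qE] := PA c a; apply/bigcupP; exists q => //.
  by rewrite inE /phi /h /= (fE (a, v)) qE.
apply: leq_trans (_ : (\sum_w #|R w|) ^ 2 <= _)%N; first by rewrite leq_sqr.
apply: leq_trans (sum_sqr_leq _) _; rewrite leq_mul2l; apply/orP; right.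
rewrite (eq_bigr (fun w => \sum_(u in setX (R w) (R w)) 1)%N) => [|w _]; last first.
  by rewrite sum1_card cardsX mulnn.
rewrite pair_big_dep /= sum1_card.
rewrite -(card_in_imset (f := fun z : TP * (I * I) => z.2)) => [|[w [i1 i2]] [w' [j1 j2]]].
  apply/subset_leq_card/subsetP => _ /imsetP[[w [i1 i2]] + ->].
  rewrite -[_ \in _]/((i1, i2) \in setX (R w) (R w)) in_setX !inE => /andP[/eqP h1 /eqP h2].
  by rewrite -/(phi _) -/(phi _) h1 h2.
rewrite -[_ \in _]/((i1, i2) \in setX (R w) (R w)) in_setX !inE => /andP[/eqP h _].
rewrite -[_ \in _]/((j1, j2) \in setX (R w') (R w')) in_setX !inE => /andP[/eqP h' _].
by move=> /= [E1 E2]; rewrite -E1 h -E2 in h' *; rewrite (injP h').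
Qed.
End Energy.

(** * Deduction of the lower bound *)

(** Compares the two energy bounds and cancels [a * v]. Removing [- al] from [A], so that inverses
    exist, keeps at least half of [A]; hence the factor 2. *)
Lemma prod_shift_energy (F : fieldType) (p : nat) (A : {fset F}) (al : F) (m : nat) :
  let a := #|` A| in let q := #|` prod_shift A al| in
  p \in [pchar F] -> 0 \notin A -> (1 < a)%N -> al != 0 ->
  (3 * (q * a ^ 2) <= m.+1 ^ 2)%N -> (6 * m <= p)%N ->
  (a ^ 4 <= 2 * q ^ 2 * (33 * m + 2 * a + 1))%N.
Proof.
move=> a q charF A0 a1 al0 hm mp.
pose A' := (A `\ (- al))%fset.
pose P (w : prod_shift A al) : F := val w.
pose X (w : A) : F := val w.
pose V (w : A') : F := (val w + al)^-1.
have Vn (w : A') : val w + al != 0.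
  by have := valP w; rewrite in_fsetD1 addr_eq0 => /andP[].
have V0 w : V w != 0 by rewrite invr_eq0.
have X0 w : X w != 0.
  by apply: contraNneq A0 => <-; exact: valP.
have injP : injective P by exact: val_inj.
have injX : injective X by exact: val_inj.
have injV : injective V by move=> w w' /invr_inj /addIr /val_inj.
have PI x y : x \in A -> y \in A -> x * (y + al) \in prod_shift A al.
  by move=> xA yA; exact: in_imfset2.
have PV w v : exists u, P u * V v = X w.
  have vA : val v \in A by have := valP v; rewrite in_fsetD1 => /andP[].
  by exists (FSetSub (PI _ _ (valP w) vA)); rewrite /P /V /X /= mulfK ?Vn.
have PX c w : exists u, P u = X c * (al + X w).
  by exists (FSetSub (PI _ _ (valP c) (valP w))); rewrite /P /X /= addrC.
have := energy_lower injP injX PV PX.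
have va : (a <= 2 * #|{: A'}|)%N.
  rewrite -cardfE; move: a1; rewrite /a (cardfsD1 (- al) A) -/A'.
  by move: (#|` A'|) => k; case: (- al \in A) => /=; lia.
have va' : (#|{: A'}| <= a)%N by rewrite -cardfE fsubset_leq_card // fsubD1set.
have := @energy_bound F _ p (@tofrac {poly F} \o polyC) (tofrac 'X) charF (@tofrac_cubic_inj F)
  _ _ _ P X V al injP injX injV X0 V0 al0 m.
rewrite -!cardfE in va va' *; rewrite -/a -/q.
set v := #|`A'| in va va' *; set N := energy _ _ _ _.
rewrite (maxn_idPl va') => /(_ _ mp) hN hE.
have {}hN : (N <= q * a * v * (33 * m + 2 * a + 1))%N.
  by apply: hN; apply: leq_trans hm; rewrite leq_mul2l -mulnA leq_mul2l -mulnn leq_mul2l va' !orbT.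
have := leq_trans hE (leq_mul (leqnn q) hN).
have v0 : (0 < v)%N by lia.
have -> : ((a ^ 2 * v) ^ 2 = a * v * (a ^ 3 * v))%N by ring.
have -> : (q * (q * a * v * (33 * m + 2 * a + 1)) = a * v * (q ^ 2 * (33 * m + 2 * a + 1)))%N.
  by ring.
rewrite leq_pmul2l ?muln_gt0 ?v0 ?andbT ?(ltnW a1) // => h.
apply: (@leq_trans (2 * (a ^ 3 * v))); last by rewrite -mulnA leq_mul2l.
by rewrite mulnCA (expnSr a 3) leq_mul2l va orbT.
Qed.

Lemma nat_sqrt_exists n : exists m, (m ^ 2 <= n < m.+1 ^ 2)%N.
Proof.
elim: n => [|n [m /andP[h1 h2]]]; first by exists 0%N.
have [h|h] := ltnP n.+1 (m.+1 ^ 2)%N.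
  by exists m; rewrite h andbT ltnW.
by exists m.+1; rewrite h /= (leq_ltn_trans h2) // ltn_exp2r.
Qed.

Theorem proposition10 (R : realType) :
  exists c : R, 0 < c /\
    forall (F : fieldType) (p : nat) (A : {fset F}) (alpha : F),
      p \in [pchar F] -> odd p ->
      0 \notin A ->
      (1 < #|` A|)%N ->
      (#|` A|%:R : R) < p%:R `^ (8 / 13) ->
      alpha != 0 ->
      c * #|` A|%:R `^ (9 / 8) <= (#|` prod_shift A alpha|)%:R.
Proof.
(* As 108 = 3 * 36, the bound [m ^ 2 <= 3 * q * a ^ 2] becomes [(6 * m) ^ 2 <= s ^ 25] with
   [a = s ^ 8]. The final contradiction only asks 2 * 36 < 108 ^ 2. *)
exists (108%:R^-1); split; first by rewrite invr_gt0 ltr0n.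
move=> F p A alpha charF _ A0 a1 ap al0.
rewrite leNgt; apply/negP => small.
have [m /andP[m1 m2]] := nat_sqrt_exists (3 * (#|` prod_shift A alpha| * #|` A| ^ 2)).
have grow := prod_shift_energy charF A0 a1 al0 (ltnW m2).
move: a1 ap small m1 grow {m2}; move: #|` A| #|` prod_shift A alpha| => a q a1 ap small m1 grow.
(* These roots make all exponents integral, and the size hypothesis becomes [s < r]. *)
pose s : R := a%:R `^ 8%:R^-1; pose r : R := p%:R `^ 13%:R^-1.
have pw (n k l : nat) : (0 < l)%N -> (n%:R : R) `^ (k%:R / l%:R) = (n%:R `^ l%:R^-1) ^+ k.
  by move=> l0; rewrite mulrC powRrM powR_mulrn // powR_ge0.
have pw1 (n l : nat) : (0 < l)%N -> (n%:R `^ l%:R^-1) ^+ l = n%:R :> R.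
  by move=> l0; rewrite -pw // divff ?pnatr_eq0 -?lt0n // powRr1.
rewrite pw // -/r in ap; rewrite pw // -/s in small.
have aE : a%:R = s ^+ 8 by rewrite pw1.
have pE : p%:R = r ^+ 13 by rewrite pw1.
have s0 : 0 <= s by exact: powR_ge0.
have r0 : 0 <= r by exact: powR_ge0.
have s1 : 1 <= s.
  by rewrite -(@expr_ge1 _ 8) // -aE ler1n ltnW.
have sr : s < r by rewrite -(@ltr_pXn2r _ 8) // -aE.
have r1 : 1 <= r by apply: le_trans s1 (ltW sr).
have m2 : m%:R ^+ 2 <= s ^+ 25 / 36%:R.
  apply: (@le_trans _ _ (3%:R * (q%:R * a%:R ^+ 2))).
    by rewrite -!natrX -!natrM ler_nat.
  have : q%:R * s ^+ 16 <= 108%:R^-1 * s ^+ 9 * s ^+ 16.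
    by rewrite ler_wpM2r ?exprn_ge0 // ltW.
  rewrite -mulrA -exprD aE -exprM => h; lra.
have s25 k : (25 <= k)%N -> s ^+ 25 <= s ^+ k by move=> h; rewrite ler_weXn2l.
(* The condition [6 * m <= p] holds since [(6 * m) ^ 2 <= s ^ 25 <= r ^ 25 <= r ^ 26 = p ^ 2]. *)
have {}grow : (a ^ 4 <= 2 * q ^ 2 * (33 * m + 2 * a + 1))%N.
  apply: grow; rewrite -(ler_nat R) -(@ler_pXn2r _ 2) ?nnegrE ?ler0n //.
  rewrite pE -exprM natrM exprMn.
  have sr25 : s ^+ 25 <= r ^+ 25 by rewrite lerXn2r ?nnegrE // ltW.
  have r25 : r ^+ 25 <= r ^+ 26 by rewrite ler_weXn2l.
  rewrite /=; lra.
have ms : m%:R <= s ^+ 14.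
  rewrite -(@ler_pXn2r _ 2) ?nnegrE ?ler0n ?exprn_ge0 // -exprM.
  have := s25 28%N isT; have := exprn_ge0 25 s0; rewrite /=; lra.
move: grow; rewrite -(ler_nat R); apply/negP; rewrite -ltNge.
rewrite !(natrD, natrM, natrX) aE -exprM.
have s8 : s ^+ 8 <= s ^+ 14 by rewrite ler_weXn2l.
have s14 : 1 <= s ^+ 14 by rewrite exprn_ege1.
have f36 : 33%:R * m%:R + 2%:R * s ^+ 8 + 1%:R <= 36%:R * s ^+ 14 by lra.
have q2 : q%:R ^+ 2 <= (108%:R^-1 * s ^+ 9) ^+ 2.
  by rewrite lerXn2r ?nnegrE ?ler0n ?(ltW small) // (le_trans (ler0n _ q)) // ltW.
apply: le_lt_trans (ler_pM _ _ (ler_wpM2l _ q2) f36) _; rewrite ?ler0n //.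
- by rewrite !addr_ge0 ?mulr_ge0 ?ler0n ?exprn_ge0.
have w0 : 0 < s ^+ 18 * s ^+ 14 by rewrite mulr_gt0 ?exprn_gt0 // (lt_le_trans ltr01).
rewrite exprMn -[(s ^+ 9) ^+ 2]exprM -[(8 * 4)%N]/(18 + 14)%N exprD /=; lra.
Qed.
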